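(* Let $m\ge 6$ be an even integer and let $\theta\in(0,1]$. For $\nu>0$ let $$M=M(\nu)=(I-\theta\nu L)^{-1}\bigl(I+(1-\theta)\nu L\bigr)\in\mathbb{R}^{m\times m}$$ be the matrix of the iteration $u^{n+1}=Mu^n$ obtained by discretizing the advection equation $U_t=aU_x$ ($a>0$) on $[0,1]$ with periodic boundary condition by the fourth-order centered discretization in space with $m$ spatial grid points and the $\theta$-method in time, where $\nu=a\,\Delta t/\Delta x$ is the CFL number. Then there exists $\nu_0>0$ such that the matrix $M$ has at least one negative entry for any $\nu>\nu_0$.
   Context: $L\in\mathbb{R}^{m\times m}$ is the circulant matrix of the fourth-order centered difference scheme (stencil width 5): with indices taken modulo $m$, $L_{i,i-2}=\frac1{12}$, $L_{i,i-1}=-\frac23$, $L_{i,i}=0$, $L_{i,i+1}=\frac23$, $L_{i,i+2}=-\frac1{12}$ for $1\le i\le m$, and all other entries are $0$. $\Delta x=1/m$ and $\Delta t>0$ are the spatial and temporal step sizes. The $\theta$-method applied to $u'=\frac{a}{\Delta x}Lu$ is $u^{n+1}=u^n+\nu\bigl((1-\theta)Lu^n+\theta Lu^{n+1}\bigr)$. $I$ is the identity matrix. *)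

(* Defs.v *)
From HB Require Import structures.
From mathcomp Require Import all_boot all_order all_algebra.
From mathcomp Require Import reals.

Set Implicit Arguments.
Unset Strict Implicit.
Unset Printing Implicit Defensive.

Import Order.TTheory GRing.Theory Num.Theory.
Local Open Scope ring_scope.

(* Rows and columns are numbered from 0 to m - 1.  The tests below overlap
   when m < 5, so this is the five-point stencil only for m >= 5. *)
Definition diff4_mx (R : realType) (m : nat) : 'M[R]_m :=
  \matrix_(i < m, j < m)
    if (j + 2 == i %[mod m])%N then 1 / 12
    else if (j + 1 == i %[mod m])%N then - (2 / 3)
    else if (j == i + 1 %[mod m])%N then 2 / 3
    else if (j == i + 2 %[mod m])%N then - (1 / 12)
    else 0.

(* Solving u' = u + nu ((1 - theta) L u + theta L u') for u' gives u' = M u.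
   As L is skew-symmetric for m >= 5, the inverted matrix is then a unit. *)
Definition theta_mx (R : realType) (m : nat) (theta nu : R) : 'M[R]_m :=
  let L := diff4_mx R m in
  invmx (1%:M - (theta * nu) *: L) *m (1%:M + ((1 - theta) * nu) *: L).

(* Main.v *)
Require Import Defs.
From HB Require Import structures.
From mathcomp Require Import all_boot all_order all_algebra.
From mathcomp Require Import reals.
From mathcomp Require Import ring lra.

Set Implicit Arguments.
Unset Strict Implicit.
Unset Printing Implicit Defensive.

Import Order.TTheory GRing.Theory Num.Theory.
Local Open Scope ring_scope.

(** The iteration has a negative entry for every [nu > 0], by an argument
    on the parity of the indices.

    For even [m] the constant vector and the alternating vector [(-1) ^+ j] are
    both in the kernel of [L := diff4_mx R m] ([diff4_mx_ker]), so the iteration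
    matrix [M] fixes them.  If all the entries of [M] were nonnegative, then
    subtracting the two identities [\sum_j M i j = 1] and
    [\sum_j M i j * (-1) ^+ j = (-1) ^+ i] would show that every row of [M]
    puts no weight on the columns of the other parity ([parity_decoupling]):
    [M] would commute with the diagonal matrix of alternating signs.  So would
    [theta *: M + (1 - theta)%:M], which is the inverse of [1 - theta nu L], and
    so would [1 - theta nu L] itself.  This is absurd, because the stencil
    couples each point with its immediate neighbours, which have the other
    parity, with the nonzero weight [2 / 3].

    That [1 - theta nu L] is invertible comes from the skew-symmetry of [L]
    ([unitmx_1_sub_skew]). *)

(** Written as a sum, the stencil becomes linear in the four shifts.  This
    requires the four tests to exclude each other: two of them together would
    make one of 1, 2, 3, 4 divisible by [m]. *)
Lemma diff4_mxE (R : realType) (m : nat) (i j : 'I_m) : (5 <= m)%N ->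
  diff4_mx R m i j =
    1 / 12 * (j + 2 == i %[mod m])%N%:R - 2 / 3 * (j + 1 == i %[mod m])%N%:R
    + 2 / 3 * (j == i + 1 %[mod m])%N%:R - 1 / 12 * (j == i + 2 %[mod m])%N%:R.
Proof.
move=> m5; rewrite mxE.
have excl (a b : nat) : (a < 5)%N -> (b < 5)%N -> a != b ->
    forall k, (k + a == k + b %[mod m])%N = false.
  move=> a5 b5 ab k; rewrite eqn_modDl !modn_small ?(leq_trans _ m5) //.
  exact: negbTE.
have excl0 (b k : nat) : (0 < b)%N -> (b < 5)%N ->
    (k == k + b %[mod m])%N = false.
  by move=> b0 b5; rewrite -[RHS](excl 0 b _ _ _ k)%N ?addn0 // eq_sym -lt0n.
have shift (a b k l : nat) : (k == l %[mod m])%N ->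
    (b == k + a %[mod m])%N = (b == l + a %[mod m])%N.
  by move=> /eqP kl; rewrite -modnDml kl modnDml.
case: ifP => [e2|_].
  have ie : (i == j + 2 %[mod m])%N by rewrite eq_sym.
  have -> : (j + 1 == i %[mod m])%N = false.
    by rewrite -(eqP e2) excl.
  rewrite !(shift _ _ _ _ ie) -!addnA !excl0 //=; lra.
case: ifP => [e1|_].
  have ie : (i == j + 1 %[mod m])%N by rewrite eq_sym.
  rewrite !(shift _ _ _ _ ie) -!addnA !excl0 //=; lra.
case: ifP => [/eqP ->|_]; first by rewrite excl //=; lra.
by case: ifP => _ /=; lra.
Qed.

Lemma trmx_diff4 (R : realType) (m : nat) :
  (5 <= m)%N -> (diff4_mx R m)^T = - diff4_mx R m.
Proof.
move=> m5; apply/matrixP => i j; rewrite mxE [RHS]mxE !diff4_mxE //.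
rewrite [(i + 2 == j %[mod m])%N]eq_sym [(i + 1 == j %[mod m])%N]eq_sym.
rewrite [(i == j + 1 %[mod m])%N]eq_sym [(i == j + 2 %[mod m])%N]eq_sym.
lra.
Qed.

Lemma sum_eq_mod (R : realType) (m k : nat) (f : nat -> R) : (0 < m)%N ->
  (forall j, f (j %% m)%N = f j) ->
  \sum_(j < m) (j == k %[mod m])%N%:R * f j = f k.
Proof.
move=> m0 fper; rewrite (bigD1 (Ordinal (ltn_pmod k m0))) //= big1 => [|j].
  by rewrite modn_mod eqxx mul1r fper addr0.
rewrite -val_eqE /= (modn_small (ltn_ord j)) => /negbTE ->.
by rewrite mul0r.
Qed.

(** The stencil is odd, and a geometric sequence of ratio [c] with
    [c ^+ 2 = 1] takes the same value at the distances [k] and [- k]; it is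
    [m]-periodic because [m] is even. *)
Lemma diff4_mx_ker (R : realType) (m : nat) (c : R) :
  (5 <= m)%N -> ~~ odd m -> c ^+ 2 = 1 ->
  diff4_mx R m *m \col_(j < m) c ^+ j = 0.
Proof.
move=> m5 me c2; have m0 : (0 < m)%N by apply: leq_trans m5.
have cm : c ^+ m = 1.
  by rewrite -(even_halfK me) -mul2n exprM c2 expr1n.
have cper j : c ^+ (j %% m)%N = c ^+ j.
  by rewrite [in RHS](divn_eq j m) exprD mulnC exprM cm expr1n mul1r.
have back (i j k : nat) : (k <= m)%N ->
    (j + k == i %[mod m])%N = (j == i + (m - k) %[mod m])%N.
  by move=> km; rewrite -(eqn_modDr k j) -addnA subnK // modnDr.
apply/matrixP => i l; rewrite mxE [RHS]mxE.
under eq_bigr => j _.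
  rewrite diff4_mxE // mxE !back ?(leq_trans _ m5) //.
  rewrite mulrBl mulrDl mulrBl -!mulrA.
  over.
rewrite sumrB big_split sumrB /= -!mulr_sumr.
rewrite !(sum_eq_mod _ m0 cper).
have cback k : (k <= m)%N -> c ^+ (m - k) = c ^+ k.
  move=> km; rewrite -[LHS]mulr1 -(expr1n _ k) -c2 -exprM mul2n -addnn.
  by rewrite exprD mulrA -exprD subnK // cm mul1r.
rewrite !exprD !cback ?(leq_trans _ m5) //; ring.
Qed.

(** If [v] is fixed by a skew matrix [B], then [v *m v^T = v *m B *m v^T] is its
    own opposite, so that the sum of the squares of the entries of [v] is 0. *)
Lemma unitmx_1_sub_skew (R : realFieldType) (m : nat) (B : 'M[R]_m) :
  B^T = - B -> 1%:M - B \in unitmx.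
Proof.
move=> skew; rewrite -row_free_unit; apply/inj_row_free => v.
rewrite mulmxBr mulmx1 => /eqP; rewrite subr_eq0 => /eqP fix_v.
have : v *m v^T = - (v *m v^T).
  rewrite {1}fix_v -mulmxA -[B in LHS]opprK -skew mulNmx mulmxN.
  by rewrite -trmx_mul -fix_v.
move=> /matrixP /(_ 0 0); rewrite [RHS]mxE => e.
have {e} : (v *m v^T) 0 0 = 0 by lra.
rewrite mxE => /eqP; rewrite psumr_eq0; last first.
  by move=> k _; rewrite mxE -expr2 sqr_ge0.
move=> /allP z; apply/matrixP => i k; rewrite ord1 [RHS]mxE.
have := z k (mem_index_enum k).
by rewrite /= mxE mulf_eq0 orbb => /eqP.
Qed.

(** In row [i], the two fixed-point equations give
    [\sum_j A i j * (1 - (-1) ^+ (i + j)) = 0], a sum of nonnegative terms. *)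
Lemma parity_decoupling (R : realFieldType) (m : nat) (A : 'M[R]_m) :
  (forall i j, 0 <= A i j) ->
  (forall c : R, c ^+ 2 = 1 -> A *m \col_j c ^+ j = \col_j c ^+ j) ->
  forall i j : 'I_m, odd i != odd j -> A i j = 0.
Proof.
move=> A0 fixA i j ij.
have row c : c ^+ 2 = 1 -> \sum_k A i k * c ^+ k = c ^+ i.
  move=> /fixA /matrixP /(_ i 0); rewrite !mxE => <-.
  by apply: eq_bigr => k _; rewrite mxE.
have pos k : 0 <= A i k * (1 - (-1) ^+ i * (-1) ^+ k).
  apply: mulr_ge0 (A0 i k) _; rewrite -exprD -signr_odd.
  by case: (odd _); rewrite ?expr1 ?expr0 /=; lra.
have /eqP : \sum_k A i k * (1 - (-1) ^+ i * (-1) ^+ k) = 0.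
  under eq_bigr => k _ do rewrite mulrBr mulrCA -[X in A i k * X](expr1n R k).
  rewrite sumrB -mulr_sumr !row ?sqrrN ?expr1n //.
  by rewrite -expr2 -exprM mulnC exprM sqrrN !expr1n subrr.
rewrite psumr_eq0 => [/allP /(_ j (mem_index_enum j)) /= |k _]; last exact: pos.
rewrite -exprD -signr_odd oddD; move: ij; case: (odd i); case: (odd j) => // _.
  all: by rewrite /= expr1 mulf_eq0 => /orP [/eqP //|/eqP] /=; lra.
Qed.

(** The sign pattern [\row_j (-1) ^+ j] separates the two parities. *)
Lemma parity_commute (R : realFieldType) (m : nat) (A : 'M[R]_m) :
  let S := diag_mx (\row_j (-1) ^+ j) in
  (forall i j : 'I_m, odd i != odd j -> A i j = 0) <-> A *m S = S *m A.
Proof.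
move=> S; split=> [A0 | AS i j ij].
  apply/matrixP => i j; rewrite mul_mx_diag mul_diag_mx !mxE.
  have [ij|/A0 ->] := eqVneq (odd i) (odd j); last by rewrite mulr0 mul0r.
  by rewrite mulrC -signr_odd -ij signr_odd.
have := congr1 (fun B : 'M_m => B i j) AS.
rewrite mul_mx_diag mul_diag_mx !mxE -signr_odd -[_ ^+ i]signr_odd.
by move: ij; case: (odd i); case: (odd j) => // _; rewrite ?expr1 ?expr0 /=; lra.
Qed.

Section ThetaMethod.

Variables (R : realType) (m : nat) (theta nu : R).
Hypotheses (m6 : (6 <= m)%N) (m_even : ~~ odd m).

Let L := diff4_mx R m.
Let N : 'M_m := 1%:M - (theta * nu) *: L.
Let M := theta_mx m theta nu.

Let m5 : (5 <= m)%N. Proof. exact: ltnW. Qed.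

Lemma implicit_unitmx : N \in unitmx.
Proof. by apply: unitmx_1_sub_skew; rewrite linearZ /= trmx_diff4 // scalerN. Qed.

Lemma theta_mx_fix (c : R) : c ^+ 2 = 1 ->
  M *m \col_j c ^+ j = \col_j c ^+ j.
Proof.
move=> c2; have Lu := diff4_mx_ker m5 m_even c2.
rewrite /M /theta_mx -/L -/N -mulmxA mulmxDl mul1mx -scalemxAl Lu scaler0 addr0.
rewrite -[in LHS](_ : N *m (\col_j c ^+ j) = \col_j c ^+ j).
  by rewrite mulKmx ?implicit_unitmx.
by rewrite mulmxBl mul1mx -scalemxAl Lu scaler0 subr0.
Qed.

(** The explicit factor [E := 1 + (1 - theta) nu L] of [M] satisfies
    [theta E + (1 - theta) N = 1], where the terms in [L] cancel. *)
Lemma theta_mx_inv : theta *: M + (1 - theta) *: 1%:M = invmx N.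
Proof.
have -> : (1 - theta) *: 1%:M = invmx N *m ((1 - theta) *: N).
  by rewrite -scalemxAr mulVmx ?implicit_unitmx.
rewrite /M /theta_mx -/L -/N scalemxAr -mulmxDr -[RHS]mulmx1; congr (_ *m _).
by apply/matrixP => i j; rewrite /N !mxE; ring.
Qed.

Lemma theta_mx_neg : 0 < theta -> 0 < nu -> exists i j, M i j < 0.
Proof.
move=> theta0 nu0.
have [/existsP [i /existsP [j Mij]]|Mpos] :=
  boolP [exists i, exists j, M i j < 0]; first by exists i, j.
have {}Mpos i j : 0 <= M i j.
  rewrite leNgt; apply: contra Mpos => Mij.
  by apply/existsP; exists i; apply/existsP; exists j.
have /parity_commute MS := parity_decoupling Mpos theta_mx_fix.
set S := diag_mx _ in MS.
have NS : invmx N *m S = S *m invmx N.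
  rewrite -theta_mx_inv mulmxDl mulmxDr -!scalemxAl -!scalemxAr MS.
  by rewrite mul1mx mulmx1.
have {}NS : N *m S = S *m N.
  rewrite -[LHS](mulmxKV implicit_unitmx) -(mulmxA N) -NS.
  by rewrite (mulKVmx implicit_unitmx).
have lt0 : (0 < m)%N by apply: leq_trans m6.
have lt1 : (1 < m)%N by apply: leq_trans m6.
have L01 : L (Ordinal lt0) (Ordinal lt1) = 2 / 3.
  by rewrite /L diff4_mxE //= !modn_small ?(leq_trans _ m6) //=; lra.
have := (parity_commute N).2 NS (Ordinal lt0) (Ordinal lt1) isT.
have NE i j : N i j = (i == j)%:R - theta * nu * L i j by rewrite !mxE.
rewrite NE L01 /= => /eqP.
by rewrite add0r oppr_eq0 !mulf_eq0 invr_eq0 !pnatr_eq0 !gt_eqF.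
Qed.

End ThetaMethod.

Theorem proposition1 (R : realType) (m : nat) (theta : R) :
  (6 <= m)%N -> ~~ odd m -> 0 < theta -> theta <= 1 ->
  exists nu0 : R, 0 < nu0 /\
    forall nu : R, nu0 < nu ->
      exists i j : 'I_m, theta_mx m theta nu i j < 0.
Proof.
(* Every positive threshold would do. *)
move=> m6 m_even theta0 _; exists 1; split=> // nu nu1.
exact: theta_mx_neg (lt_trans ltr01 nu1).
Qed.
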